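(* (Standard Convergence) Let $f:(a,b)\to\mathbb R$ be a sufficiently differentiable function over an open interval $(a,b)$, and let $x_*\in(a,b)$. Suppose $k,N\in\mathbb N$ with $N-k\ge 1$. Then, for a given fundamental stencil $\{a_n\}_{n=1}^N$ and stencil size $h>0$, there exists a unique set of coefficients $\{c_n\}_{n=1}^N$ such that $$D^k f(x_* ) := \sum_{n=1}^N c_n f(x_*+a_n h)$$ is a finite difference approximation of $f^{(k)}(x_* )$ with accuracy order of at least $N-k$. In other words, $$\left| D^k f(x_* ) - f^{(k)}(x_* )\right| = \mathcal O(h^{N-k}).$$
   Context: An $N$-point finite difference approximation of $f^{(k)}(x_* )$ is a linear combination $\sum_{n=1}^N c_n f(x_n)$ of values of $f$ at the points of a stencil $\{x_n\}_{n=1}^N$, which is assumed to consist of distinct, ordered points $a<x_1<x_2<\cdots<x_N<b$. The stencil points are written $x_n=x_*+a_nh$, where $h>0$ is the stencil size and the real numbers $\{a_n\}_{n=1}^N$, independent of $h$, form the fundamental stencil. For real-valued functions $E,g$, $E(h)=\mathcal O(g(h))$ (as $h\to0^+$) means that there is a constant $C>0$ with $|E(h)|\le C|g(h)|$ for all sufficiently small $h>0$. The approximation has accuracy order at least $r$ if its error is $\mathcal O(h^r)$.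
   Formalization: Uniqueness fails as stated (f=0, or adding h^(N-k) to every c_n), so the coefficients must work for every N times differentiable f and are unique among those of the form c_n = h^p w_n, with w_n independent of h and p any real exponent. *)

(* Defs.v *)
From mathcomp Require Import all_boot all_order all_algebra.
From mathcomp Require Import all_classical all_reals all_analysis.

Set Implicit Arguments.
Unset Strict Implicit.
Unset Printing Implicit Defensive.

Import Order.TTheory GRing.Theory Num.Theory.
Import numFieldNormedType.Exports.

Local Open Scope classical_set_scope.
Local Open Scope ring_scope.

Definition fundamental_stencil (R : realType) (N : nat) (s : 'I_N -> R) :=
  forall i j : 'I_N, (i < j)%N -> s i < s j.

(* Functions on the open interval ]a, b[ are total functions whose values
   outside ]a, b[ are ignored: ]a, b[ being open, the iterated derivatives
   at its points only depend on the restriction of f. *)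
Definition differentiable_upto (R : realType) (m : nat) (a b : R)
    (f : R -> R) :=
  forall (j : nat) (x : R), (j < m)%N -> a < x < b -> derivable (f^`(j))%classic x 1.

(* c h i is the coefficient of the i-th stencil point for stencil size h. *)
Definition finite_difference (R : realType) (N : nat) (s : 'I_N -> R)
    (c : R -> 'I_N -> R) (f : R -> R) (x h : R) : R :=
  \sum_(i < N) c h i * f (x + s i * h).

(* For small h > 0 all the points x + s i * h lie in the interval where f is
   considered, so only small positive values of h matter. *)
Definition accuracy_order_ge (R : realType) (r k N : nat) (s : 'I_N -> R)
    (c : R -> 'I_N -> R) (f : R -> R) (x : R) :=
  (fun h : R => finite_difference s c f x h - (f^`(k))%classic x)
    =O_ (0^'+) (fun h : R => h ^+ r).

(* The coefficients scale as a common power of the stencil size. Some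
   restriction on the dependence on h is needed for coefficients to be
   determined by an asymptotic condition: adding h ^+ r to each c h i
   does not change whether the accuracy order is at least r. The exponent p
   is not prescribed. *)
Definition homogeneous_coefficients (R : realType) (N : nat)
    (c : R -> 'I_N -> R) :=
  exists p : R, forall (h : R) (i : 'I_N), 0 < h -> c h i = h `^ p * c 1 i.

(* The coefficients depend on the stencil and its size but not on f, hence the
   quantification over all the N times differentiable functions on ]a, b[. *)
Definition standard_fd_coefficients (R : realType) (a b x : R) (k N : nat)
    (s : 'I_N -> R) (c : R -> 'I_N -> R) :=
  homogeneous_coefficients c /\
  forall f : R -> R, differentiable_upto N a b f ->
    accuracy_order_ge (N - k) k s c f x.

(* Main.v *)
(** A tuple w satisfying the moment equations sum_i w_i s_i^j = k! [j = k] for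
    j < N exists and is unique, since its matrix is the Vandermonde matrix of
    the stencil. The weights h^-k w are exact on the Taylor polynomial of
    degree < N, and the Taylor remainder is O(|y - x|^N). As the N-th derivative
    need not be bounded, this remainder estimate does not come from the Lagrange
    form: it is obtained by induction on N from the mean value inequality.

    Conversely, let h^p w be an admissible choice of weights, with moments m_j.
    Testing it on (y - x)^j gives h^(p + j) m_j - k! [j = k] = O(h^(N - k)).
    The left-hand side tends to 0, so j = k forces p = - k and m_k = k!; the
    other j then give m_j = O(h^(N - j)), that is, m_j = 0. *)
Require Import Defs.
From mathcomp Require Import all_boot all_order all_algebra.
From mathcomp Require Import all_classical all_reals all_analysis.
Import Order.TTheory GRing.Theory Num.Theory.
Import numFieldNormedType.Exports.
Local Open Scope classical_set_scope.
Local Open Scope ring_scope.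

(** * Vandermonde systems and moment equations *)

Lemma Vandermonde_unit (F : fieldType) (n : nat) (s : 'I_n -> F) :
  injective s -> Vandermonde n (\row_i s i) \in unitmx.
Proof.
move=> s_inj; rewrite unitmxE det_Vandermonde unitfE.
apply/prodf_neq0 => i _; apply/prodf_neq0 => j ij.
by rewrite !mxE subr_eq0 (inj_eq s_inj) neq_ltn ij orbT.
Qed.

Lemma moment_problem_existence (F : fieldType) (n : nat) (s : 'I_n -> F)
    (m : nat -> F) : injective s ->
  exists w : 'I_n -> F, forall j, (j < n)%N -> \sum_i w i * s i ^+ j = m j.
Proof.
move=> /Vandermonde_unit Vu; set V := Vandermonde _ _ in Vu.
pose w : 'cV_n := invmx V *m \col_(j < n) m j.
have Vw : V *m w = \col_(j < n) m j by rewrite mulKVmx.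
exists (fun i => w i 0) => j jn.
have /matrixP/(_ (Ordinal jn) 0) := Vw; rewrite !mxE => <-.
by apply: eq_bigr => i _; rewrite !mxE mulrC.
Qed.

Lemma moment_problem_uniqueness (F : fieldType) (n : nat) (s v w : 'I_n -> F) :
  injective s ->
  (forall j, (j < n)%N -> \sum_i v i * s i ^+ j = \sum_i w i * s i ^+ j) ->
  v =1 w.
Proof.
move=> /Vandermonde_unit Vu; set V := Vandermonde _ _ in Vu => vw i.
suff /colP/(_ i) : \col_i v i = \col_i w i :> 'cV_n by rewrite !mxE.
apply: (can_inj (mulKmx Vu)); apply/colP => j; rewrite !mxE.
have := vw j (ltn_ord j); under eq_bigr do rewrite mulrC.
under [RHS]eq_bigr do rewrite mulrC.
by move=> e; under eq_bigr do rewrite !mxE; under [RHS]eq_bigr do rewrite !mxE.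
Qed.

(** * Iterated derivatives of polynomials *)

Lemma derivn_comp_XsubC (R : comNzRingType) (p : {poly R}) (c : R) (n : nat) :
  (p \Po ('X - c%:P))^`(n) = p^`(n) \Po ('X - c%:P).
Proof.
elim: n => [|n IHn]; first by rewrite !derivn0.
by rewrite !derivnS IHn deriv_comp derivB derivX derivC subr0 mulr1.
Qed.

Lemma derive1n_horner (R : realType) (p : {poly R}) (n : nat) :
  (horner p)^`(n)%classic = horner p^`(n).
Proof.
by elim: n => [|n IHn]; rewrite ?derivn0 // derive1nS IHn -derivE derivnS.
Qed.

Lemma differentiable_upto_horner (R : realType) (a b : R) (m : nat)
    (p : {poly R}) : differentiable_upto m a b (horner p).
Proof. by move=> j x _ _; rewrite derive1n_horner; apply: derivable_horner. Qed.

Lemma derive1n_horner_XsubC (R : realType) (p : {poly R}) (x : R) (n : nat) :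
  (horner (p \Po ('X - x%:P)))^`(n)%classic x = p`_n *+ n`!.
Proof.
rewrite derive1n_horner derivn_comp_XsubC horner_comp !hornerE subrr.
by rewrite horner_coef0 coef_derivn addn0 ffactnn.
Qed.

(** * Taylor polynomials and the remainder estimate *)

(** The variable is the increment [y - x], and [n] counts terms, so the degree is below [n]. *)
Definition taylor_poly {R : realType} (n : nat) (f : R -> R) (x : R) :
    {poly R} :=
  \poly_(j < n) ((f^`(j))%classic x / j`!%:R).

(** Hence the Taylor remainder of [f] has as derivative that of the derivative of [f], which drives
    the induction on the order. *)
Lemma deriv_taylor_poly (R : realType) (n : nat) (f : R -> R) (x : R) :
  (taylor_poly n.+1 f x)^`() = taylor_poly n f^`()%classic x.
Proof.
apply/polyP => j; rewrite coef_deriv !coef_poly ltnS derive1Sn.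
case: ifP => _; last by rewrite mul0rn.
by rewrite factS natrM invfM -[LHS]mulr_natr mulrA mulrAC divfK ?pnatr_eq0.
Qed.

Lemma near_interval (R : realType) (a b x : R) : a < x < b ->
  \forall y \near x, a < y < b.
Proof.
move=> /andP[ax xb]; near=> y; apply/andP; split; near: y.
  exact: lt_nbhsr.
exact: lt_nbhsl.
Unshelve. all: by end_near. Qed.

(** The difference quotient converges to some [l], so it is eventually bounded by [|l| + 1]. *)
Lemma derivable_near_bound (R : realType) (f : R -> R) (x : R) :
  derivable f x 1 ->
  exists2 C : R, 0 <= C & \forall y \near x, `|f y - f x| <= C * `|y - x|.
Proof.
move=> /(cvgr_norm_le _) df; set l := lim _ in df.
have {}df := df _ (ltr_pwDr ltr01 (lexx `|l|)).
exists (`|l| + 1); first by rewrite addr_ge0.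
apply/nbhs0P; move: df; rewrite near_withinE.
apply: filterS => h /=; have [->|h0 /(_ isT)] := eqVneq h 0.
  by rewrite addr0 !subrr normr0 mulr0.
rewrite normrZ normfV ler_pdivrMl ?normr_gt0// [h *: 1]mulr1 mulrC.
by rewrite [x + h]addrC addrK.
Qed.

(** Locating [z] by its distance to [x] treats both sides of [x] at once and fits balls centred at
    [x]. *)
Lemma mean_value_sym (R : realType) (g dg : R -> R) (x y : R) :
  (forall z, `|z - x| <= `|y - x| -> is_derive z 1 g (dg z)) ->
  exists2 z, `|z - x| <= `|y - x| & g y - g x = dg z * (y - x).
Proof.
move=> gd; have [xy|/ltW yx] := leP x y.
  have zP z : z \in `[x, y] -> `|z - x| <= `|y - x|.
    by rewrite in_itv/= => /andP[xz zy]; rewrite !ger0_norm ?subr_ge0// lerB.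
  have [||z /zP zx e] := @MVT_segment _ g dg x y xy; last by exists z.
    by move=> z /subset_itv_oo_cc/zP/gd.
  by apply: derivable_within_continuous => z /zP/gd.
have zP z : z \in `[y, x] -> `|z - x| <= `|y - x|.
  rewrite in_itv/= => /andP[yz zx].
  by rewrite !ler0_norm ?subr_le0// lerN2 lerB.
have [||z /zP zx e] := @MVT_segment _ g dg y x yx.
- by move=> z /subset_itv_oo_cc/zP/gd.
- by apply: derivable_within_continuous => z /zP/gd.
by exists z => //; rewrite -opprB e -mulrN opprB.
Qed.

Lemma derivative_bound_expr (R : realType) (g dg : R -> R) (x C : R) (n : nat) :
  0 <= C ->
  (\forall y \near x, is_derive (y : R) 1 g (dg y)) ->
  (\forall y \near x, `|dg y| <= C * `|y - x| ^+ n) ->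
  g x = 0 -> \forall y \near x, `|g y| <= C * `|y - x| ^+ n.+1.
Proof.
move=> C0 gd dgC gx0; have [e /= e0 xe] := (nbhs_ballP _ _).1 (filterI gd dgC).
apply/nbhs_ballP; exists e => //= y xy.
have inball z : `|z - x| <= `|y - x| -> ball x e z.
  move: xy; rewrite -!ball_normE /= distrC => xy /le_lt_trans/(_ xy).
  by rewrite distrC.
have [|z /[dup] /inball/xe[_ dgz] zy] := @mean_value_sym _ g dg x y.
  by move=> z /inball/xe[].
rewrite gx0 subr0 => ->; rewrite normrM exprSr mulrA ler_wpM2r//.
by rewrite (le_trans dgz)// ler_wpM2l// lerXn2r.
Qed.

(** The induction differentiates [f] and so ends at its [n]-th derivative, whose derivability at [x]
    gives a linear bound. *)
Lemma taylor_remainder_bound (R : realType) (a b x : R) (n : nat) (f : R -> R) :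
  a < x < b -> differentiable_upto n.+1 a b f ->
  exists2 C : R, 0 <= C & \forall y \near x,
    `|f y - (taylor_poly n.+1 f x).[y - x]| <= C * `|y - x| ^+ n.+1.
Proof.
move=> xab; elim: n f => [|n IHn] f fd.
  have [C C0 fC] := derivable_near_bound _ _ _ (fd 0 x isT xab).
  exists C => //; apply: filterS fC => y.
  by rewrite /taylor_poly horner_poly big_ord1 !expr0 mulr1 fact0 divr1.
have [|C C0 dfC] := IHn f^`()%classic.
  by move=> j y jn yab; rewrite -derive1Sn; apply: fd.
exists C => //; apply: derivative_bound_expr C0 _ dfC _.
  apply: filterS (near_interval _ _ _ _ xab) => y yab.
  have fy : is_derive y 1 f (f^`()%classic y).
    by rewrite derive1E; apply/derivableP/(fd 0).
  (* Composing with ['X - x%:P] gives a polynomial in [y], to be differentiated formally. *)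
  have Ty : is_derive y 1 (horner (taylor_poly n.+2 f x \Po ('X - x%:P)))
      (taylor_poly n.+1 f^`()%classic x).[y - x].
    rewrite -deriv_taylor_poly; set p := _ \Po _.
    have /derivableP : derivable (horner p) y 1 by exact: derivable_horner.
    rewrite -derive1E -derivE /p deriv_comp derivB derivX derivC subr0 mulr1.
    by rewrite horner_comp !hornerE.
  have -> : (fun y0 => f y0 - (taylor_poly n.+2 f x).[y0 - x]) =
      f \- horner (taylor_poly n.+2 f x \Po ('X - x%:P)).
    by apply/funext => z /=; rewrite horner_comp !hornerE.
  exact: is_deriveB.
rewrite subrr horner_coef0 coef_poly/= fact0 divr1 subrr//.
Qed.

(** * Existence: accuracy of the weights solving the moment equations *)

Lemma sum_horner_moments (F : comNzRingType) (n m : nat) (s w : 'I_n -> F)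
    (p : {poly F}) (h : F) : (size p <= m)%N ->
  \sum_i w i * p.[s i * h] = \sum_(j < m) p`_j * h ^+ j * \sum_i w i * s i ^+ j.
Proof.
move=> pm; under eq_bigr do rewrite (horner_coef_wide _ pm) mulr_sumr.
rewrite exchange_big; apply: eq_bigr => j _; rewrite mulr_sumr.
apply: eq_bigr => i _; rewrite exprMn mulrCA -mulrA; congr (_ * _).
by rewrite mulrA mulrC.
Qed.

Lemma near_scaled_shift (R : realType) (n : nat) (s : 'I_n -> R) (x : R)
    (P : R -> Prop) : (\forall y \near x, P y) ->
  \forall h \near (0 : R)^'+, forall i, P (x + s i * h).
Proof.
move=> xP; apply: filter_forall => i.
suff : x + s i * h @[h --> (0 : R)^'+] --> x by apply.
apply: cvg_at_right_filter.
rewrite -[X in _ --> X]addr0 -[X in _ --> _ + X](mulr0 (s i)).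
apply: cvgD; first exact: cvg_cst.
by apply: cvgM; [exact: cvg_cst | exact: cvg_id].
Qed.

Definition fd_coef {R : realType} (k : nat) {N : nat} (w : 'I_N -> R) (h : R)
    (i : 'I_N) : R :=
  h `^ (- k%:R) * w i.

Lemma accuracy_fd_coef (R : realType) (a b x : R) (k N : nat) (s w : 'I_N -> R)
    (f : R -> R) : a < x < b -> (k < N)%N ->
  (forall j, (j < N)%N -> \sum_i w i * s i ^+ j = k`!%:R *+ (j == k)) ->
  differentiable_upto N a b f ->
  accuracy_order_ge (N - k) k s (fd_coef k w) f x.
Proof.
case: N s w => // n s w xab kn wm fd.
have [C C0 fC] := taylor_remainder_bound _ _ _ _ _ _ xab fd.
set T := taylor_poly n.+1 f x in fC.
(* The triangle inequality and the remainder bound at each point [x + s i * h] give this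
   constant. *)
pose K := \sum_i `|w i| * (C * `|s i| ^+ n.+1).
have K0 : 0 <= K by apply: sumr_ge0 => i _; rewrite !mulr_ge0.
(* The moment equations keep only the [k]-th Taylor term, and its moment cancels the denominator
   [k!]. *)
have main h : \sum_i w i * T.[s i * h] = (f^`(k))%classic x * h ^+ k.
  rewrite (sum_horner_moments _ _ n.+1) ?size_poly//.
  rewrite (bigD1 (Ordinal kn))//= [X in _ + X]big1 ?addr0 => [|j jk].
    by rewrite wm// eqxx coef_poly kn mulrAC divfK// pnatr_eq0 -lt0n fact_gt0.
  by rewrite wm// -[k]/(val (Ordinal kn)) val_eqE (negPf jk) mulr0.
(* [K] may vanish, whereas the constant must be positive. *)
apply/eqO_exP; exists (K + 1); first by rewrite ltr_wpDl.
near=> h.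
have h0 : 0 < h by near: h; exact: nbhs_right_gt.
have -> : finite_difference s (fd_coef k w) f x h - (f^`(k))%classic x =
    h ^- k * \sum_i w i * (f (x + s i * h) - T.[s i * h]).
  rewrite /finite_difference /fd_coef.
  under eq_bigr do rewrite powR_invn ?ltW// -mulrA.
  rewrite -mulr_sumr; under [in RHS]eq_bigr do rewrite mulrBr.
  rewrite sumrB main mulrBr; congr (_ - _).
  by rewrite mulrCA mulVf ?mulr1// expf_neq0// gt_eqF.
rewrite normrM normfV !normrX (gtr0_norm h0) ler_pdivrMl ?exprn_gt0//.
have -> : h ^+ k * ((K + 1) * h ^+ (n.+1 - k)) = (K + 1) * h ^+ n.+1.
  by rewrite mulrCA -(exprD h) (subnKC (ltnW kn)).
apply: (@le_trans _ _ (K * h ^+ n.+1)); last first.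
  by rewrite ler_wpM2r ?exprn_ge0 ?(ltW h0)// lerDl.
rewrite (le_trans (ler_norm_sum _ _ _))// mulr_suml; apply: ler_sum => i _.
rewrite normrM -!mulrA ler_wpM2l//.
rewrite -[X in _ * X ^+ _](gtr0_norm h0) -exprMn -normrM.
(* Quantifying over [i] makes this a single condition on small [h]. *)
suff : forall i, `|f (x + s i * h) - T.[x + s i * h - x]| <=
    C * `|x + s i * h - x| ^+ n.+1.
  by move=> /(_ i); rewrite [x + _ - x]addrAC subrr add0r.
by near: h; exact: (near_scaled_shift _ _ s x _ fC).
Unshelve. all: by end_near. Qed.

(** * Uniqueness: asymptotics at [0^'+] determine exponent and moments *)

Lemma cvg_expr_at_right0 (R : realType) (C : R) (r : nat) :
  C * h ^+ r.+1 @[h --> (0 : R)^'+] --> (0 : R).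
Proof.
apply: cvg_at_right_filter.
have {2}<- : C * 0 ^+ r.+1 = 0 by rewrite expr0n mulr0.
by apply: cvgM; [exact: cvg_cst | exact: exprn_continuous].
Qed.

Lemma norm_le_expr_eq0 (R : realType) (m C : R) (r : nat) :
  (\forall h \near (0 : R)^'+, `|m| <= C * h ^+ r.+1) -> m = 0.
Proof.
move=> mC; apply: contrapT => /eqP; rewrite -normr_gt0 => m0.
near (0 : R)^'+ => h.
suff : `|m| < `|m| by rewrite ltxx.
apply: (@le_lt_trans _ _ (C * h ^+ r.+1)); first by near: h.
by near: h; apply: (cvgr_lt 0 _ _ m0); exact: cvg_expr_at_right0.
Unshelve. all: by end_near. Qed.

(** The exponent [r.+1] is positive, so the bound tends to 0; this is where [1 <= N - k] enters
    uniqueness. *)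
Lemma eqO_expr_cvg (R : realType) (f : R -> R) (c : R) (r : nat) :
  (fun h : R => f h - c) =O_ ((0 : R)^'+) (fun h => h ^+ r.+1) ->
  f h @[h --> (0 : R)^'+] --> c.
Proof.
move=> /eqO_exP[C C0 fC]; apply/cvgrPdist_le => e e0; near=> h.
have h0 : 0 < h by near: h; exact: nbhs_right_gt.
apply: (@le_trans _ _ (C * h ^+ r.+1)).
  rewrite distrC -[X in X ^+ _](gtr0_norm h0) -normrX.
  by near: h.
by near: h; apply: (cvgr_le 0 _ _ e0); exact: cvg_expr_at_right0.
Unshelve. all: by end_near. Qed.

Lemma powR_leading_term_uniq (R : realType) (q m c : R) (r : nat) : c != 0 ->
  (fun h : R => h `^ q * m - c) =O_ ((0 : R)^'+) (fun h => h ^+ r.+1) ->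
  q = 0 /\ m = c.
Proof.
move=> c0 /eqO_expr_cvg qmc.
have uniq := @cvg_unique R^o (@norm_hausdorff _ _)
  ((fun h => h `^ q * m) @ (0 : R)^'+) _.
have q0 : q = 0.
  apply/eqP; case: ltgtP => // q0; exfalso.
    (* If [q < 0], multiplying by [h ^ (- q)], which tends to 0, forces [m = 0], so the limit [c]
       would be 0. *)
    have m0 : 0 * c = m.
      apply: (@cvg_unique R^o (@norm_hausdorff _ _)
        ((fun h => h `^ (- q) * (h `^ q * m)) @ (0 : R)^'+)).
        by apply: cvgM => //; apply: powR_cvg0; rewrite oppr_gt0.
      apply: cvg_near_cst; near=> h.
      have h0 : 0 < h by near: h; exact: nbhs_right_gt.
      by rewrite powRN mulKf// gt_eqF// powR_gt0.
    move/eqP: c0; apply; apply: uniq => //.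
    by apply: cvg_near_cst; apply: nearW => h; rewrite -m0 mul0r mulr0.
  (* If [q > 0], the power itself tends to 0, and again [c] would be 0. *)
  move/eqP: c0; apply; apply: uniq => //.
  have : h `^ q * m @[h --> (0 : R)^'+] --> 0 * m.
    by apply: cvgM; [exact: powR_cvg0 | exact: cvg_cst].
  by rewrite mul0r.
split=> //; apply: uniq => //.
by apply: cvg_near_cst; apply: nearW => h; rewrite q0 powRr0 mul1r.
Unshelve. all: by end_near. Qed.

Lemma standard_fd_coefficients_moments (R : realType) (a b x : R) (k N : nat)
    (s : 'I_N -> R) (c : R -> 'I_N -> R) :
  (k < N)%N -> standard_fd_coefficients a b x k s c ->
  (forall h i, 0 < h -> c h i = fd_coef k (c 1) h i) /\
  (forall j, (j < N)%N -> \sum_i c 1 i * s i ^+ j = k`!%:R *+ (j == k)).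
Proof.
move=> kN [[p cp] acc]; pose M j := \sum_i c 1 i * s i ^+ j.
have test j : (fun h => h `^ p * h ^+ j * M j - k`!%:R *+ (j == k))
    =O_ ((0 : R)^'+) (fun h => h ^+ (N - k)).
  have /acc/eqO_exP[C C0 PC] :=
    differentiable_upto_horner _ a b N ('X^j \Po ('X - x%:P)).
  apply/eqO_exP; exists C => //; near=> h.
  have h0 : 0 < h by near: h; exact: nbhs_right_gt.
  suff <- : finite_difference s c (horner ('X^j \Po ('X - x%:P))) x h
      - (horner ('X^j \Po ('X - x%:P)))^`(k)%classic x =
      h `^ p * h ^+ j * M j - k`!%:R *+ (j == k).
    by near: h.
  rewrite derive1n_horner_XsubC coefXn eq_sym; congr (_ - _); last first.
    by case: eqP; rewrite // mul0rn.
  rewrite /finite_difference /M mulr_sumr; apply: eq_bigr => i _.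
  rewrite cp// horner_comp !hornerE [x + _ - x]addrAC subrr add0r exprMn.
  by rewrite /= -!mulrA; congr (_ * _); rewrite [RHS]mulrC -mulrA.
have powRDn (h : R) j : 0 < h -> h `^ p * h ^+ j = h `^ (p + j%:R).
  by move=> h0; rewrite -powR_mulrn ?ltW// powRD// (gt_eqF h0) implybT.
have [r Nkr] : exists r, (N - k = r.+1)%N.
  by exists (N - k).-1; rewrite prednK// subn_gt0.
have [pk Mk] : p + k%:R = 0 /\ M k = k`!%:R.
  (* The test [j = k] has the nonzero constant [k!] and total exponent [p + k]. *)
  apply: (@powR_leading_term_uniq _ _ _ _ r).
    by rewrite pnatr_eq0 -lt0n fact_gt0.
  have := test k; rewrite eqxx mulr1n Nkr => /eqO_exP[C C0 PC].
  apply/eqO_exP; exists C => //; near=> h.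
  rewrite -powRDn; last by near: h; exact: nbhs_right_gt.
  by near: h.
have {pk} pE : p = - k%:R by apply/eqP; rewrite -addr_eq0 pk.
split=> [h i h0|j jN]; first by rewrite cp// /fd_coef pE.
have [->//|jk] := eqVneq j k.
(* The test gives [h^(j - k) M j = O(h^(N - k))]. Multiplying by [h ^+ k] before cancelling [h ^+ j]
   avoids the sign of [j - k]; the exponent left, [N - j], is positive. *)
have /eqO_exP[C C0 PC] := test j; apply: (@norm_le_expr_eq0 _ _ C (N - j).-1).
rewrite prednK ?subn_gt0//; near=> h.
have h0 : 0 < h by near: h; exact: nbhs_right_gt.
have : `|h `^ p * h ^+ j * M j - k`!%:R *+ (j == k)| <= C * `|h ^+ (N - k)|.
  by near: h.
rewrite (negPf jk) mulr0n subr0 pE powR_invn ?(ltW h0)//.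
rewrite !normrM normfV !normrX (gtr0_norm h0).
rewrite -mulrA ler_pdivrMl ?exprn_gt0// mulrCA -exprD subnKC ?(ltnW kN)//.
have -> : C * h ^+ N = h ^+ j * (C * h ^+ (N - j)).
  by rewrite mulrCA -(exprD h) (subnKC (ltnW jN)).
by rewrite ler_pM2l// exprn_gt0.
Unshelve. all: by end_near. Qed.

Theorem theorem2p1 (R : realType) (a b x : R) (hx : a < x < b)
    (k N : nat) (hkN : (1 <= N - k)%N)
    (s : 'I_N -> R) (hs : fundamental_stencil s) :
  exists c : R -> 'I_N -> R,
    standard_fd_coefficients a b x k s c /\
    (forall c' : R -> 'I_N -> R, standard_fd_coefficients a b x k s c' ->
      forall (h : R) (i : 'I_N), 0 < h -> c' h i = c h i).
Proof.
have kN : (k < N)%N by rewrite -subn_gt0.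
have s_inj : injective s.
  move=> i j sij; have [ij|ij|/val_inj//] := ltngtP i j;
  by have := hs _ _ ij; rewrite sij ltxx.
have [w wm] := moment_problem_existence _ _ s
  (fun j => k`!%:R *+ (j == k)) s_inj.
exists (fd_coef k w); split.
  split; last by move=> f; apply: accuracy_fd_coef.
  by exists (- k%:R) => h i _; rewrite /fd_coef powR1 mul1r.
move=> c' c'fd h i h0.
have [c'E c'm] := standard_fd_coefficients_moments _ _ _ _ _ _ _ _ kN c'fd.
(* Both families are [h^(-k)] times their weights at [h = 1], so equal moments suffice. *)
rewrite c'E// /fd_coef (moment_problem_uniqueness _ _ s _ w)// => j jN.
by rewrite c'm// wm.
Qed.
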